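(* There is an absolute constant $c>0$ such that for all sufficiently large $n$ there exists a tree metric $T$ with $n$ points such that any oblivious $\frac13$-reliable $2$-spanner for $V(T)$ must have at least $c\,n\log n$ edges; that is, for every distribution $\mathcal{D}$ of graphs on $V(T)$ that is an oblivious $\frac13$-reliable $2$-spanner for $V(T)$, some graph in the support of $\mathcal{D}$ has at least $c\,n\log n$ edges.
   Context: A tree metric $T$ with $n$ points is the shortest-path metric $\delta_T$ on the vertex set $V(T)$ of a tree with $n$ vertices and positive edge weights. Let $(X,\delta_X)$ be a metric space and $P\subseteq X$ a set of $n$ points. A $t$-spanner of $P$ is an edge-weighted graph $G=(P,E,w)$ with $w(p,q)=\delta_X(p,q)$ for each edge and $\delta_G(x,y)\le t\cdot\delta_X(x,y)$ for all $x,y\in P$, where $\delta_G$ denotes shortest-path distance in $G$. Let $\nu\in(0,1)$. A $t$-spanner $G$ of $P$ is (deterministic) $\nu$-reliable if for every subset $B\subseteq P$ there is a set $B^+$ with $B\subseteq B^+\subseteq P$ and $|B^+|\le(1+\nu)|B|$ such that $G[P\setminus B]$ is a $t$-spanner for the points in $P\setminus B^+$, i.e. $\delta_{G[P\setminus B]}(x,y)\le t\cdot\delta_X(x,y)$ for all $x,y\in P\setminus B^+$. An oblivious $\nu$-reliable $t$-spanner is a random $t$-spanner $G$ of $P$ drawn from a distribution $\mathcal{D}$ such that for every $B\subseteq P$ there is a (possibly $G$-dependent) set $B^+\supseteq B$ such that $\delta_{G[P\setminus B]}(x,y)\le t\cdot\delta_X(x,y)$ for all $x,y\in P\setminus B^+$,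 and $\mathbb{E}_{G\sim\mathcal{D}}[|B^+|]\le(1+\nu)|B|$. *)

(* Defs.v *)
From mathcomp Require Import all_boot all_order all_algebra.
From mathcomp Require Import boolp classical_sets reals ereal exp.

Set Implicit Arguments.
Unset Strict Implicit.
Unset Printing Implicit Defensive.

Import Order.TTheory GRing.Theory Num.Theory.
Local Open Scope ring_scope.

(* A simple graph on V is its set of edges, which are 2-element subsets of V. *)
Definition edges_ok (V : finType) (E : {set {set V}}) : bool :=
  [forall e in E, #|e| == 2%N].

Definition graph (V : finType) : finType := {E : {set {set V}} | edges_ok E}.

Definition edges (V : finType) (G : graph V) : {set {set V}} := val G.

Definition adj (V : finType) (E : {set {set V}}) : rel V :=
  fun x y => [set x; y] \in E.

(* Edge set of the induced subgraph on A.  The vertices outside A stay in the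
   type V as isolated vertices, which does not affect distances within A. *)
Definition induced (V : finType) (E : {set {set V}}) (A : {set V}) :
    {set {set V}} :=
  [set e in E | e \subset A].

Definition walk_length (R : realType) (V : finType) (w : V -> V -> R)
    (x : V) (s : seq V) : R :=
  \sum_(e <- zip (x :: s) s) w e.1 e.2.

(* Shortest-path distance; it is +oo when x and y are not connected. *)
Definition gdist (R : realType) (V : finType) (E : {set {set V}})
    (w : V -> V -> R) (x y : V) : \bar R :=
  ereal_inf [set (walk_length w x s)%:E |
             s in [set s | path (adj E) x s /\ last x s = y]]%classic.

Definition is_tree (V : finType) (T : graph V) : Prop :=
  (forall x y : V, connect (adj (edges T)) x y) /\
  (forall s : seq V, (2 < size s)%N -> uniq s -> ~~ cycle (adj (edges T)) s).

Definition positive_weights (R : realType) (V : finType) (G : graph V)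
    (w : {set V} -> R) : Prop :=
  forall e : {set V}, e \in edges G -> 0 < w e.

(* The distance is finite because a tree is connected. *)
Definition tree_metric (R : realType) (V : finType) (T : graph V)
    (w : {set V} -> R) (x y : V) : R :=
  fine (gdist (edges T) (fun u v => w [set u; v]) x y).

(* The edge set E, with each edge weighted by d, has stretch at most t for all
   pairs of points of S. *)
Definition spans (R : realType) (V : finType) (d : V -> V -> R) (t : R)
    (E : {set {set V}}) (S : {set V}) : Prop :=
  forall x y : V, x \in S -> y \in S -> (gdist E d x y <= (t * d x y)%:E)%E.

Definition spanner (R : realType) (V : finType) (d : V -> V -> R) (t : R)
    (G : graph V) : Prop :=
  spans d t (edges G) [set: V].

(* There are finitely many graphs on V, and the weights of a spanner are
   determined by d, so a mass function is the most general distribution. *)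
Definition distribution (R : realType) (V : finType) (D : graph V -> R) : Prop :=
  (forall G : graph V, 0 <= D G) /\ \sum_(G : graph V) D G = 1.

Definition oblivious_reliable_spanner (R : realType) (V : finType)
    (d : V -> V -> R) (nu t : R) (D : graph V -> R) : Prop :=
  [/\ distribution D,
      forall G : graph V, 0 < D G -> spanner d t G
    & forall B : {set V}, exists Bplus : graph V -> {set V},
        (forall G : graph V, 0 < D G ->
           B \subset Bplus G /\
           spans d t (induced (edges G) (~: B)) (~: Bplus G)) /\
        \sum_(G : graph V) D G * #|Bplus G|%:R <= (1 + nu) * #|B|%:R].

(* Main.v *)
(* The tree is a caterpillar: a spine with unit edges and a pendant leaf of edge
   weight n at each spine vertex.  The adversary deletes the spine.  Then in some
   graph of the support about two thirds of the leaves survive, and a pair of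
   surviving leaves at index distance D must be joined by at most two hops through
   a leaf z, whose index distances to the pair sum to at most 2D.  Hence one
   endpoint of the pair has an edge of index length in [D/2, 2D].  Comparing each
   leaf with its shift by D shows that linearly many leaves have such an edge, and
   the scales D = 8^k are pairwise disjoint, so that log n of them add up. *)
Require Import Defs.
From mathcomp Require Import all_boot all_order all_algebra.
From mathcomp Require Import boolp classical_sets reals ereal exp.
From mathcomp Require Import zify lra.

Set Implicit Arguments.
Unset Strict Implicit.
Unset Printing Implicit Defensive.

Import Order.TTheory GRing.Theory Num.Theory.
Local Open Scope ring_scope.

(** * The caterpillar and its distance in closed form *)

(* Vertex 2i is the i-th spine vertex and 2i+1 is its leaf, so the parent of v > 0
   is v.-1./2.*2 in both cases. *)
Definition spine_gap (x y : nat) : nat := ((x./2 - y./2) + (y./2 - x./2))%N.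

(** The diagonal is split off because the general formula would put a leaf at distance [2n] from
    itself. *)
Definition cat_dist (n x y : nat) : nat :=
  if x == y then 0%N else (odd x * n + odd y * n + spine_gap x y)%N.

(** Joining each positive vertex to its parent gives a tree for odd [n] too: the last spine vertex
    then has no leaf. *)
Definition cat_edges (n : nat) : {set {set 'I_n}} :=
  [set e | [exists u : 'I_n, exists v : 'I_n,
     [&& e == [set u; v], (0 < v)%N & u == v.-1./2.*2 :> nat]]].

Lemma cat_edges_ok n : edges_ok (cat_edges n).
Proof.
apply/forall_inP => e; rewrite inE => /existsP[u /existsP[v /and3P[/eqP-> v0 /eqP uv]]].
rewrite cards2 -val_eqE /= uv.
by have -> : (v.-1./2.*2 != v)%N by lia.
Qed.

Definition caterpillar (n : nat) : graph 'I_n :=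
  exist (fun E : {set {set 'I_n}} => is_true (edges_ok E))
    (cat_edges n) (cat_edges_ok n).

Definition cat_weight (R : realType) (n : nat) (e : {set 'I_n}) : R :=
  if [exists v in e, odd v] then n%:R else 1.

Lemma cat_adjP n (x y : 'I_n) :
  reflect (((0 < y)%N /\ x = y.-1./2.*2 :> nat) \/
           ((0 < x)%N /\ y = x.-1./2.*2 :> nat))
          (adj (edges (caterpillar n)) x y).
Proof.
apply: (iffP idP) => [|xy]; last first.
  rewrite /adj inE; apply/existsP.
  case: xy => -[p e].
    by exists x; apply/existsP; exists y; rewrite eqxx p e eqxx.
  by exists y; apply/existsP; exists x; rewrite finset.setUC eqxx p e eqxx.
rewrite /adj inE => /existsP[u /existsP[v /and3P[/eqP/setP e v0 /eqP uv]]].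
have := e u; have := e v; have := e x; have := e y.
rewrite !inE !eqxx ?orbT /= -!val_eqE /=; lia.
Qed.

Lemma cat_weight_edge (R : realType) n (x y : 'I_n) :
  adj (edges (caterpillar n)) x y ->
  cat_weight R [set x; y] = (cat_dist n x y)%:R.
Proof.
move=> /cat_adjP xy; rewrite /cat_weight.
have -> : [exists v in [set x; y], odd v] = odd x || odd y.
  apply/existsP/idP => [[v]|/orP[o|o]].
  - by rewrite !inE => /andP[/orP[]/eqP-> ->]; rewrite ?orbT.
  - by exists x; rewrite !inE eqxx.
  - by exists y; rewrite !inE eqxx orbT.
have -> : cat_dist n x y = if odd x || odd y then n else 1%N.
  rewrite /cat_dist /spine_gap; have := ltn_ord x; case: eqP.
    by case: xy; lia.
  case: xy => -[]; case ox: (odd x); case oy: (odd y); rewrite /= ?mul1n ?mul0n; lia.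
by case: ifP.
Qed.

Lemma cat_dist_triangle n x y z :
  (cat_dist n x z <= cat_dist n x y + cat_dist n y z)%N.
Proof.
rewrite /cat_dist /spine_gap; case: eqP => [|xz]; first lia.
case: eqP => [<-|_]; first by case: eqP => //; lia.
case: eqP => [->|_]; first by lia.
by move: (odd x * n)%N (odd y * n)%N (odd z * n)%N => a b c; lia.
Qed.

(** * The closed form is the shortest-path metric *)

(** The triangle inequality is summed along the walk; this bounds the infimum from below in
    [cat_metric]. *)
Lemma cat_walk_ge (R : realType) n (s : seq 'I_n) (x : 'I_n) :
  path (adj (edges (caterpillar n))) x s ->
  (cat_dist n x (last x s))%:R <=
    walk_length (fun u v => cat_weight R [set u; v]) x s.
Proof.
elim: s x => [|y s IH] x /=.
  by move=> _; rewrite /cat_dist eqxx /walk_length /= big_nil.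
case/andP => xy /IH le; rewrite /walk_length /= big_cons /= cat_weight_edge //.
apply: le_trans (lerD (lexx _) le); rewrite -natrD ler_nat.
exact: cat_dist_triangle.
Qed.

Definition cat_geodesic (R : realType) n (x y : 'I_n) : Prop :=
  exists s, [/\ path (adj (edges (caterpillar n))) x s, last x s = y &
    walk_length (fun u v => cat_weight R [set u; v]) x s = (cat_dist n x y)%:R].

Lemma walk_length_cat (R : realType) (V : finType) (w : V -> V -> R) x s t :
  walk_length w x (s ++ t) = walk_length w x s + walk_length w (last x s) t.
Proof.
elim: s x => [|y s IH] x; first by rewrite {2}/walk_length /= big_nil add0r.
by rewrite /walk_length /= !big_cons -addrA; congr (_ + _); exact: IH.
Qed.

Lemma cat_geodesic_trans (R : realType) n (x y z : 'I_n) :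
  cat_geodesic R x y -> cat_geodesic R y z ->
  cat_dist n x z = (cat_dist n x y + cat_dist n y z)%N -> cat_geodesic R x z.
Proof.
move=> [s [ps ls ws]] [t [pt lt wt]] e; exists (s ++ t).
by rewrite cat_path last_cat walk_length_cat ls ps pt lt ws wt e natrD.
Qed.

Lemma cat_geodesic_edge (R : realType) n (x y : 'I_n) :
  adj (edges (caterpillar n)) x y -> cat_geodesic R x y.
Proof.
move=> xy; exists [:: y]; rewrite /= xy; split=> //.
by rewrite /walk_length /= big_seq1 cat_weight_edge.
Qed.

Lemma spine_gapC x y : spine_gap x y = spine_gap y x.
Proof. by rewrite /spine_gap addnC. Qed.

Lemma cat_distC n x y : cat_dist n x y = cat_dist n y x.
Proof.
by rewrite /cat_dist eq_sym spine_gapC (addnC (odd x * n)%N).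
Qed.

(** Halving is monotone, so the spine index of the parent of [x] lies between those of [y] and [x],
    and the gaps add up. *)
Lemma spine_gap_parent x y : (y < x)%N ->
  spine_gap x y = (spine_gap x x.-1./2.*2 + spine_gap x.-1./2.*2 y)%N.
Proof.
move=> yx; rewrite /spine_gap doubleK.
have : (x.-1./2 <= x./2)%N by apply: half_leq; lia.
have : (y./2 <= x.-1./2)%N by apply: half_leq; lia.
move: x./2 y./2 x.-1./2 => a b c; lia.
Qed.

Lemma cat_dist_parent n x y : (y < x)%N ->
  cat_dist n x y = (cat_dist n x x.-1./2.*2 + cat_dist n x.-1./2.*2 y)%N.
Proof.
move=> yx; rewrite /cat_dist spine_gap_parent // odd_double mul0n addn0 add0n.
have -> : (x == x.-1./2.*2) = false.
  by apply/eqP => e; have := odd_double_half x.-1; lia.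
rewrite (gtn_eqF yx); case: eqP => [<-|_].
  by rewrite odd_double mul0n /spine_gap subnn !addn0.
by rewrite addnACA.
Qed.

(* The larger endpoint is left through its parent, which lies on the tree path. *)
Lemma cat_geodesicP (R : realType) n (x y : 'I_n) : cat_geodesic R x y.
Proof.
have [k] := ubnP (x + y); elim: k x y => // k IH x y xyk.
have parent_lt (v : 'I_n) : (0 < v)%N -> (v.-1./2.*2 < v)%N.
  by move=> v0; have := odd_double_half v.-1; lia.
case: (ltngtP x y) => [xy|yx|/val_inj->].
- have py : (y.-1./2.*2 < y)%N by apply: parent_lt; lia.
  have e : adj (edges (caterpillar n)) (Ordinal (ltn_trans py (ltn_ord y))) y.
    by apply/cat_adjP; left; split=> //; apply: leq_ltn_trans xy.
  apply: cat_geodesic_trans (IH _ _ _) (cat_geodesic_edge R e) _.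
    by apply: leq_trans (xyk : (_ <= k)%N); rewrite ltn_add2l.
  by rewrite cat_distC cat_dist_parent // addnC; congr (_ + _)%N; apply: cat_distC.
- have px : (x.-1./2.*2 < x)%N by apply: parent_lt; lia.
  have e : adj (edges (caterpillar n)) x (Ordinal (ltn_trans px (ltn_ord x))).
    by apply/cat_adjP; right; split=> //; apply: leq_ltn_trans yx.
  apply: cat_geodesic_trans (cat_geodesic_edge R e) (IH _ _ _) _.
    by apply: leq_trans (xyk : (_ <= k)%N); rewrite ltn_add2r.
  exact: cat_dist_parent.
- by exists [::]; rewrite /walk_length /= big_nil /cat_dist eqxx.
Qed.

Lemma cat_metric (R : realType) n (x y : 'I_n) :
  tree_metric (caterpillar n) (@cat_weight R n) x y = (cat_dist n x y)%:R.
Proof.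
rewrite /tree_metric /gdist.
set A := (X in ereal_inf X); suff -> : ereal_inf A = ((cat_dist n x y)%:R)%:E by [].
apply/eqP; rewrite eq_le; apply/andP; split.
  apply: ereal_inf_lbound; have [s [ps ls ws]] := cat_geodesicP R x y.
  by exists s; rewrite ?ws.
apply: le_ereal_inf_tmp => _ [s [ps <-] <-].
by rewrite lee_fin cat_walk_ge.
Qed.

(** * Absence of cycles *)

(** The largest vertex of a cycle would have two distinct smaller neighbours, but its only smaller
    neighbour is its parent. *)
Lemma caterpillar_acyclic n (s : seq 'I_n) :
  (2 < size s)%N -> uniq s -> ~~ cycle (adj (edges (caterpillar n))) s.
Proof.
move=> s2 us; apply/negP => cs.
have [v vs vmax] : exists2 v, v \in s & forall u, u \in s -> (u <= v)%N.
  case: s s2 {us cs} => // a s _.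
  have am : a \in a :: s by rewrite mem_head.
  by case: (@arg_maxnP _ a (mem (a :: s)) (@nat_of_ord n) am) => v vs vm; exists v.
have [i t st] := rot_to vs.
have tlt u : u \in t -> (u < v)%N.
  move=> ut; have : u \in rot i s by rewrite st inE ut orbT.
  rewrite mem_rot => /vmax; rewrite leq_eqVlt => /orP[/eqP/val_inj uv|//].
  by move: us; rewrite -(rot_uniq i) st /= -uv ut.
move: cs us s2; rewrite -(rot_cycle i) -(rot_uniq i) -(size_rot i) st /=.
case: t {st} tlt => // a t; case/lastP: t => // t b tlt /=.
rewrite rcons_path last_rcons => /and3P[/cat_adjP va _ /cat_adjP bv] /and3P[_ + _] _.
have av : (a < v)%N by apply: tlt; rewrite mem_head.
have bv' : (b < v)%N by apply: tlt; rewrite inE mem_rcons mem_head orbT.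
have -> : a = b by apply: val_inj => /=; lia.
by rewrite mem_rcons mem_head.
Qed.

(** * Counting vertex pairs at one scale and over all scales *)

(** Halving is injective on odd numbers and turns the shift by [D.*2] into a shift by [D]. The
    halves of [Z] and their shifts are thus disjoint subsets of an interval of length [n./2 + D]. *)
Lemma odd_shift_free_card n D (Z : {set 'I_n}) :
  (forall x, x \in Z -> odd x) ->
  (forall x y, x \in Z -> y \in Z -> y <> x + D.*2 :> nat)%N ->
  (4 * #|Z| <= n + D.*2)%N.
Proof.
move=> oZ sZ.
suff : (size ([seq x./2 | x : 'I_n in Z] ++ [seq (x./2 + D)%N | x : 'I_n in Z])
        <= size (iota 0 (n./2 + D)))%N.
  rewrite size_cat !size_map -!cardE size_iota. move: #|Z| => z. lia.
apply: uniq_leq_size => [|i].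
  rewrite cat_uniq !map_inj_in_uniq ?enum_uniq ?andbT /=.
  - apply/hasPn => _ /mapP[x + ->]; rewrite mem_enum => xZ.
    apply/negP => /mapP[y]; rewrite mem_enum => yZ e.
    by apply: (sZ _ _ xZ yZ); have := oZ _ xZ; have := oZ _ yZ; lia.
  - move=> x y; rewrite !mem_enum => /oZ ox /oZ oy e; apply: val_inj => /=; lia.
  - move=> x y; rewrite !mem_enum => /oZ ox /oZ oy e; apply: val_inj => /=; lia.
rewrite mem_cat mem_iota => /orP[] /mapP[x]; rewrite mem_enum => /oZ ox ->;
  have := ltn_ord x; lia.
Qed.

(** Each edge has two orientations: the pairs over the edge {a, b} are among (a, b) and (b, a). *)
Lemma card_edge_pairs (V : finType) (E : {set {set V}}) : edges_ok E ->
  (#|[set p : V * V | [set p.1; p.2] \in E]| <= 2 * #|E|)%N.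
Proof.
move=> /forall_inP okE; rewrite -sum1_card.
rewrite (partition_big (fun p => [set p.1; p.2]) (mem E)) /=; last first.
  by move=> p; rewrite inE.
rewrite mulnC -sum_nat_const; apply: leq_sum => e eE.
have /cards2P[a [b [ab ->]]] := okE e eE.
rewrite sum1_card; apply: leq_trans (_ : #|[set (a, b); (b, a)]| <= 2)%N; last first.
  by rewrite cards2; case: (_ != _).
apply: subset_leq_card; apply/fintype.subsetP => -[p q].
rewrite !inE /= => /andP[_ /eqP/setP h].
have : a \in [set p; q] by rewrite h !inE eqxx.
have : b \in [set p; q] by rewrite h !inE eqxx orbT.
rewrite !inE => /orP[]/eqP bE /orP[]/eqP aE; subst; rewrite ?eqxx ?orbT //;
  by rewrite eqxx in ab.
Qed.

(** Pairs are ordered so that the first projection yields the vertices with an edge in the window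
    [D/2, 2D]. *)
Definition scale_pairs n (E : {set {set 'I_n}}) (D : nat) : {set 'I_n * 'I_n} :=
  [set p | [&& [set p.1; p.2] \in E, (D <= 2 * spine_gap p.1 p.2)%N &
               (spine_gap p.1 p.2 <= 2 * D)%N]].

(** [Z] collects the vertices of [S] without an edge at scale [D]. By the hub hypothesis no two of
    them have index distance [D], so the shift bound applies to [Z]; the rest of [S] is charged to
    [A]. *)
Lemma card_scale_pairs n (E : {set {set 'I_n}}) (S : {set 'I_n}) D :
  (0 < D)%N -> (forall x, x \in S -> odd x) ->
  (forall x y, x \in S -> y \in S -> x != y -> exists z : 'I_n,
     (x, z) \in scale_pairs E (spine_gap x y) \/
     (y, z) \in scale_pairs E (spine_gap x y)) ->
  (4 * #|S| <= 4 * #|scale_pairs E D| + n + D.*2)%N.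
Proof.
move=> D0 oS hub; set A := scale_pairs E D.
set Z := S :\: [set p.1 | p in A].
have : (4 * #|Z| <= n + D.*2)%N.
  apply: odd_shift_free_card => [x|x y].
    by rewrite inE => /andP[_ /oS].
  rewrite !inE => /andP[xA xS] /andP[yA yS] xy.
  have gxy : spine_gap x y = D by rewrite /spine_gap; lia.
  have nxy : x != y by rewrite -val_eqE /=; lia.
  have [z] := hub x y xS yS nxy; rewrite gxy => -[] zA.
    by move: xA; rewrite (imset_f (fun p => p.1) zA).
  by move: yA; rewrite (imset_f (fun p => p.1) zA).
have : (#|S| <= #|[set p.1 | p in A]| + #|Z|)%N.
  apply: leq_trans (leq_card_setU _ _); apply: subset_leq_card.
  by apply/fintype.subsetP => x xS; rewrite !inE xS andbT orbN.
have := leq_imset_card (fun p : 'I_n * 'I_n => p.1) A.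
move: #|Z| #|_ @: A| #|A| #|S| => z i a s. lia.
Qed.

(** The windows are disjoint: for i < j, a common gap g would give 8^j <= 2g <= 4 * 8^i, against 8 *
    8^i <= 8^j. *)
Lemma sum_scale_pairs n (E : {set {set 'I_n}}) K : edges_ok E ->
  (\sum_(k < K) #|scale_pairs E (8 ^ k)| <= 2 * #|E|)%N.
Proof.
move=> /card_edge_pairs; apply: leq_trans.
under eq_bigr do rewrite -sum1_card.
rewrite -partition_disjoint_bigcup; last first.
  move=> i j ij; wlog lt_ij : i j ij / (i < j)%N.
    move=> wl; have [/wl->//|ji] := ltnP i j.
    by rewrite disjoint_sym wl 1?eq_sym // ltn_neqAle eq_sym ij.
  apply/pred0P => p /=; apply/negP; rewrite !inE => /andP[/and3P[_ _ p1] /and3P[_ p2 _]].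
  have : (8 * 8 ^ i <= 8 ^ j)%N by rewrite -expnS leq_pexp2l.
  have : (0 < 8 ^ i)%N by rewrite expn_gt0.
  lia.
rewrite sum1_card; apply: subset_leq_card; apply/fintype.subsetP => p /bigcupP[k _].
by rewrite !inE => /and3P[].
Qed.

(** * From short walks to edges at a prescribed scale *)

Lemma spans_walk (R : realType) n (E : {set {set 'I_n}}) (d : 'I_n -> 'I_n -> R)
    (S : {set 'I_n}) (x y : 'I_n) :
  (forall u v, d u v = (cat_dist n u v)%:R) -> spans d 2%:R E S ->
  x \in S -> y \in S ->
  exists s, [/\ path (adj E) x s, last x s = y &
    (\sum_(e <- zip (x :: s) s) cat_dist n e.1 e.2 <= 2 * cat_dist n x y)%N].
Proof.
move=> dE sp xS yS.
(* The slack 1 yields an actual walk below the infimum bound; since lengths are integers, it is then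
   rounded away. *)
have : (gdist E d x y < (2%:R * d x y + 1)%:E)%E.
  by apply: le_lt_trans (sp x y xS yS) _; rewrite lte_fin ltrDl.
move=> /ereal_inf_lt[_ [s [ps ls] <-]]; rewrite lte_fin => ws; exists s; split=> //.
move: ws; rewrite /walk_length.
rewrite (eq_bigr (fun e : 'I_n * 'I_n => (cat_dist n e.1 e.2)%:R)) => [|e _].
  by rewrite dE -natr_sum -natrM natr1 ltr_nat ltnS.
exact: dE.
Qed.

(* Each hop between leaves costs at least [2n + 1], so a walk of length at most
   [2 * (2n + gap)] has at most two hops. *)
Lemma leaf_walk_hub n (E : {set {set 'I_n}}) (s : seq 'I_n) (x y : 'I_n) :
  edges_ok E -> (forall u v, [set u; v] \in E -> odd u && odd v) ->
  path (adj E) x s -> last x s = y -> x != y ->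
  (\sum_(e <- zip (x :: s) s) cat_dist n e.1 e.2 <= 2 * cat_dist n x y)%N ->
  exists z, (x, z) \in scale_pairs E (spine_gap x y) \/
            (y, z) \in scale_pairs E (spine_gap x y).
Proof.
move=> /forall_inP okE oE.
have hop (u v : 'I_n) : adj E u v ->
    [/\ odd u, odd v, u != v & cat_dist n u v = (n + n + spine_gap u v)%N].
  move=> uv; have /andP[ou ov] := oE _ _ uv; have := okE _ uv.
  rewrite cards2; case nuv: (u != v) => // _; split=> //.
  by rewrite /cat_dist ou ov !mul1n val_eqE (negPf nuv).
have gap_lt (u v : 'I_n) : (spine_gap u v < n)%N.
  by have := ltn_ord u; have := ltn_ord v; rewrite /spine_gap; lia.
have gapC u v : spine_gap u v = spine_gap v u by rewrite /spine_gap addnC.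
have gap0 (u v : 'I_n) : odd u -> odd v -> u != v -> (0 < spine_gap u v)%N.
  by rewrite -val_eqE /spine_gap /=; lia.
have hop_ge (u v : 'I_n) : adj E u v -> (n + n < cat_dist n u v)%N.
  by case/hop => ou ov /(gap0 _ _ ou ov); lia.
case: s => [|a s] /=; first by move=> _ ->; rewrite eqxx.
case/andP => xa; have [ox oa nxa dxa] := hop _ _ xa.
case: s => [_ /= ay _ _|b s /= /andP[ab]].
  by exists a; left; rewrite -ay inE /= [_ \in E]xa; lia.
have [_ ob nab dab] := hop _ _ ab.
case: s => [_ /= <- nxb|c s /= /andP[bc _] _ nxy].
  rewrite !big_cons big_nil /= dxa dab.
  have -> : cat_dist n x b = (n + n + spine_gap x b)%N.
    by rewrite /cat_dist ox ob !mul1n val_eqE (negPf nxb).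
  move=> le; exists a.
  have : (spine_gap x b <= spine_gap x a + spine_gap a b)%N by rewrite /spine_gap; lia.
  (* The length bound caps both hop gaps by twice the gap of the endpoints. If the first hop is too
     short for the window, the triangle inequality makes the second long enough. *)
  have [le2 _|lt2 tri] := leqP (spine_gap x b) (2 * spine_gap x a).
    by left; rewrite inE /= [_ \in E]xa le2; lia.
  right; rewrite inE /= finset.setUC [_ \in E]ab (gapC b a); lia.
rewrite !big_cons /=.
have := hop_ge _ _ xa; have := hop_ge _ _ ab; have := hop_ge _ _ bc.
have : (cat_dist n x y <= n + n + spine_gap x y)%N.
  by rewrite /cat_dist val_eqE (negPf nxy); case: (odd x) (odd y) => -[]; lia.
(* Three hops cost more than [6n], while the budget [4n + 2 * gap] is below [6n]. *)
have := gap_lt x y; lia.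
Qed.

(** * Size of the deleted set and choice of one graph *)

Lemma card_even_ord n : (#|[set v : 'I_n | ~~ odd v]| <= n.+1./2)%N.
Proof.
suff : (size [seq x./2 | x : 'I_n in [set v : 'I_n | ~~ odd v]]
        <= size (iota 0 n.+1./2))%N.
  by rewrite size_map -cardE size_iota.
apply: uniq_leq_size => [|i].
  rewrite map_inj_in_uniq ?enum_uniq // => x y.
  by rewrite !mem_enum !inE => ox oy e; apply: val_inj => /=; lia.
rewrite mem_iota => /mapP[x]; rewrite mem_enum inE => ox ->.
by have := ltn_ord x; lia.
Qed.

(** If [f] exceeded [r] on the whole support, the nonnegative terms [D G * (f G - r)] would have sum
    at most 0 and all vanish, forcing the total mass to be 0. *)
Lemma expectation_le_exists (R : realType) (V : finType) (D f : graph V -> R) (r : R) :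
  distribution D -> \sum_(G : graph V) D G * f G <= r ->
  exists G, 0 < D G /\ f G <= r.
Proof.
move=> [D0 D1] le; apply: contrapT => no.
have fr G : 0 < D G -> r < f G.
  by move=> DG; rewrite ltNge; apply/negP => fG; apply: no; exists G.
have ge0 G : true -> 0 <= D G * (f G - r).
  move=> _; have := D0 G; rewrite le_eqVlt => /orP[/eqP<-|DG]; first by rewrite mul0r.
  by rewrite mulr_ge0 // subr_ge0 ltW // fr.
have eq0 : \sum_(G : graph V) D G * (f G - r) = 0.
  apply: le_anti; rewrite sumr_ge0 // andbT.
  under eq_bigr do rewrite mulrBr.
  by rewrite sumrB -mulr_suml D1 mul1r subr_le0.
have /eqP : \sum_(G : graph V) D G = 0.
  apply: big1 => G _; have := D0 G; rewrite le_eqVlt => /orP[/eqP<-//|DG].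
  have /eqP : D G * (f G - r) = 0 by apply: (psumr_eq0P ge0 eq0).
  by rewrite mulf_eq0 subr_eq0 !gt_eqF // fr.
by rewrite D1 oner_eq0.
Qed.

(** * Assembling the logarithmic bound *)

(** Stopping one short of [trunc_log 8 n] keeps each scale at most n/64, so the loss [n + D.*2] in
    the one-scale bound still leaves n/24 pairs. The factor 48 adds the two orientations. *)
Lemma card_edges_multiscale n (E : {set {set 'I_n}}) (S : {set 'I_n}) :
  (64 <= n)%N -> edges_ok E -> (forall x, x \in S -> odd x) ->
  (forall x y, x \in S -> y \in S -> x != y -> exists z : 'I_n,
     (x, z) \in scale_pairs E (spine_gap x y) \/
     (y, z) \in scale_pairs E (spine_gap x y)) ->
  (n <= 3 * #|S| + 2)%N ->
  ((trunc_log 8 n).-1 * n <= 48 * #|E|)%N.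
Proof.
move=> n64 okE oS hub nS; set K := (trunc_log 8 n).-1.
have scale (k : 'I_K) : (n <= 24 * #|scale_pairs E (8 ^ k)|)%N.
  have D0 : (0 < 8 ^ k)%N by rewrite expn_gt0.
  have Dn : (8 ^ k * 64 <= n)%N.
    apply: leq_trans (trunc_logP (isT : (1 < 8)%N) (_ : (0 < n)%N)); last by lia.
    by rewrite (_ : 64 = 8 ^ 2)%N // -expnD leq_exp2l // addn2; have := ltn_ord k; lia.
  have := card_scale_pairs D0 oS hub.
  move: #|scale_pairs _ _| #|S| nS => a s; lia.
have : (\sum_(k < K) n <= 24 * \sum_(k < K) #|scale_pairs E (8 ^ k)|)%N.
  by rewrite big_distrr /=; apply: leq_sum.
rewrite sum_nat_const card_ord; have := sum_scale_pairs K okE.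
move: (\sum_(k < K) _)%N #|E| (K * n)%N => a e m; lia.
Qed.

(** With t the truncated logarithm, ln n <= (t + 1) ln 8 <= 8(t + 1), which is at most 24(t - 1)
    because t >= 2. *)
Lemma ln_le_trunc_log (R : realType) n : (64 <= n)%N ->
  ln (n%:R : R) <= 24%:R * (trunc_log 8 n).-1%:R.
Proof.
move=> n64; set t := trunc_log 8 n.
have t2 : (2 <= t)%N by apply: trunc_log_max.
have lt : (n < 8 ^ t.+1)%N by apply: trunc_log_ltn.
have n0 : 0 < n%:R :> R by rewrite ltr0n; lia.
apply: (@le_trans _ _ (ln ((8%:R : R) ^+ t.+1))).
  by rewrite ler_ln ?posrE ?n0 ?exprn_gt0 ?ltr0n // -natrX ler_nat ltnW.
rewrite lnXn ?ltr0n // -[_ *+ _]mulr_natl.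
have l8 : ln (8%:R : R) <= 8%:R by apply/ltW/ln_sublinear; rewrite ltr0n.
apply: le_trans (ler_wpM2l (ler0n _ _) l8) _.
by rewrite -!natrM ler_nat; lia.
Qed.

Theorem theorem1p8 (R : realType) :
  exists c : R, 0 < c /\
  exists N : nat, forall n : nat, (N <= n)%N ->
  exists (V : finType) (T : graph V) (w : {set V} -> R),
    [/\ #|V| = n, is_tree T, positive_weights T w
      & forall D : graph V -> R,
          oblivious_reliable_spanner (tree_metric T w) (1 / 3%:R) 2%:R D ->
          exists G : graph V,
            0 < D G /\ c * n%:R * ln (n%:R) <= #|edges G|%:R].
Proof.
(* 1152 = 48 * 24, from the multiscale count and the comparison of logarithms. *)
exists (1 / 1152%:R); split; first by rewrite divr_gt0 ?ltr0n.
exists 64%N => n n64.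
exists 'I_n, (caterpillar n), (@cat_weight R n); split.
- exact: card_ord.
- split; last exact: caterpillar_acyclic.
  move=> x y; have [s [ps <- _]] := cat_geodesicP R x y.
  by apply/connectP; exists s.
- by move=> e _; rewrite /cat_weight; case: ifP => _; rewrite ?ltr01 // ltr0n; lia.
move=> D [distD _ /(_ [set v : 'I_n | ~~ odd v])[Bp [BpP]]].
set B := [set v : 'I_n | ~~ odd v] => /(expectation_le_exists distD)[G [DG BpG]].
exists G; split=> //.
have [BBp sp] := BpP G DG; set E := induced _ _ in sp.
have subE : E \subset edges G by apply/fintype.subsetP => e; rewrite inE => /andP[].
have okE : edges_ok E.
  apply/forall_inP => e /(fintype.subsetP subE).
  by have /forall_inP := valP G; apply.
have oS x : x \in ~: Bp G -> odd x.
  by rewrite inE; apply: contraR => ox; apply: (fintype.subsetP BBp); rewrite inE.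
have oE (u v : 'I_n) : [set u; v] \in E -> odd u && odd v.
  rewrite inE => /andP[_ /fintype.subsetP uvB].
  have := uvB u; have := uvB v; rewrite !inE !eqxx orbT !negbK.
  by move=> -> // ->.
have nS : (n <= 3 * #|~: Bp G| + 2)%N.
  (* The bounds 3|B+| <= 4|B| and |B| <= (n + 1)/2 leave at least (n - 2)/3 vertices outside B+. *)
  have := cardsC (Bp G); rewrite card_ord.
  have := card_even_ord n; rewrite -/B.
  have : (3 * #|Bp G| <= 4 * #|B|)%N.
    by rewrite -(ler_nat R) !natrM; lra.
  move: #|~: Bp G| #|Bp G| #|B| => s p b; lia.
have cE : ((trunc_log 8 n).-1 * n <= 48 * #|E|)%N.
  apply: (card_edges_multiscale n64 okE oS _ nS) => x y xS yS nxy.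
  have [s [ps ls ws]] := spans_walk (@cat_metric R n) sp xS yS.
  exact: leaf_walk_hub okE oE ps ls nxy ws.
have {}cE : ((trunc_log 8 n).-1 * n <= 48 * #|edges G|)%N.
  by apply: leq_trans cE _; rewrite leq_mul2l subset_leq_card.
have := ln_le_trunc_log R n64.
move: cE; rewrite -(ler_nat R) !natrM.
have : 0 <= n%:R :> R by rewrite ler0n.
by move=> n0 te /(ler_wpM2l n0) le; lra.
Qed.
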